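(* Let $p\geq2$ and let $G^*$ be a $2p$-regular plane graph of mincut $2p$ with root-vertex $v^*$. The map $\Lambda^*:(T_1^*,\dots,T_{2p}^* )\mapsto(T_2^*,T_4^*,\dots,T_{2p}^* )$ is a bijection from the set of even regular decompositions of $G^*$ to the set of reduced regular decompositions of $G^*$.
   Context: Graphs are finite, loopless, possibly with multiple edges; a plane graph is a connected planar graph with a fixed crossing-free drawing. Mincut = minimum number of edges whose deletion disconnects the graph. Root-edges $e_1^*,\dots,e_{2p}^*$ are the edges at $v^*$ in counterclockwise order; root-faces $f_1^*,\dots,f_{2p}^*$ the faces at $v^*$ in counterclockwise order with $e_i^*$ between $f_i^*$ and $f_{i+1}^*$. Other vertices are non-root. The faces of $G^*$ can be properly colored black and white (faces sharing an edge get different colors); fix the coloring in which $f_1^*$ is black. A regular decomposition of $G^*$ is a covering of its edges by $2p$ spanning trees $T_1^*,\dots,T_{2p}^*$, each oriented toward $v^*$, such that: (i) each edge not incident to $v^*$ is in exactly two trees, with opposite orientations; (ii) $e_i^*$ belongs only to $T_i^*$; (iii) around each non-root vertex $v$ the edges leading $v$ to its parent in $T_1^*,\dots,T_{2p}^*$ appear in clockwise order. It is even if, for every edge not incident to $v^*$, the indices of the two trees containing it have different parities (equivalently, it is dual to an even Schnyder decomposition of the dual $2p$-angulation). A reduced regular decomposition of $G^*$ is a partition of the edges of $G^*$ other than $e_1^*,e_3^*,\dots,e_{2p-1}^*$ into $p$ spanning trees ${T'_1}^*,\dots,{T'_p}^*$, each oriented toward $v^*$, such that: (i') every arc of these oriented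 trees has a black face on its right; (ii') the only root-edge in ${T'_i}^*$ is $e_{2i}^*$; (iii') around each non-root vertex $v$, the edges leading $v$ to its parent in ${T'_1}^*,\dots,{T'_p}^*$ appear in clockwise order. *)

(* Defs.v *)
From mathcomp Require Import all_boot.
From mathcomp Require Import functions.

Set Implicit Arguments.
Unset Strict Implicit.
Unset Printing Implicit Defensive.

(* A graph drawn on an oriented surface, encoded by its darts (half-edges):
   a dart [d] is an edge oriented out of the vertex [src d], [opp d] is the same
   edge with the other orientation, and [ccw d] is the dart following [d] in
   counterclockwise order around [src d].  Multiple edges are allowed. *)
Record rotation_system := RotationSystem {
  vertex : finType;
  dart : finType;
  src : dart -> vertex;
  opp : dart -> dart;
  ccw : dart -> dart;
  oppK : involutive opp;
  opp_neq : forall d, opp d != d;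
  ccw_inj : injective ccw;
  src_ccw : forall d d', (src d == src d') = fconnect ccw d d'
}.

Section Graph.
Variable G : rotation_system.
Implicit Types (d : dart G) (u v : vertex G).

Definition tgt d : vertex G := src (opp d).
Definition cw : dart G -> dart G := finv (@ccw G).

Definition edge d : {set dart G} := [set d; opp d].
Definition edges : {set {set dart G}} := [set edge d | d : dart G].
Implicit Type E : {set {set dart G}}.

(* Next dart along the boundary of the face lying on the left of [d]: on
   arriving at [tgt d], turn to the dart just clockwise from [opp d]. *)
Definition face_next d : dart G := cw (opp d).
Definition left_face d : {set dart G} := [set d' | fconnect face_next d d'].
Definition right_face d : {set dart G} := left_face (opp d).
Definition faces : {set {set dart G}} := [set left_face d | d : dart G].

Definition adj E : rel (vertex G) :=
  fun u v => [exists d, [&& src d == u, tgt d == v & edge d \in E]].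

(* The spanning subgraph with edge set [E] is connected. *)
Definition connected E : Prop := forall u v, connect (adj E) u v.

(* The distinctness of the edges matters only for cycles of length two, which
   consist of two parallel edges. *)
Definition is_cycle E (c : seq (dart G)) : Prop :=
  [/\ c != [::],
      cycle (fun d d' => tgt d == src d') c,
      all (fun d => edge d \in E) c,
      uniq (map (@src G) c)
    & uniq (map edge c)].

Definition spanning_tree E : Prop := connected E /\ ~ exists c, is_cycle E c.

(* Planarity of the drawing is the genus zero condition V - E + F = 2. *)
Definition plane_graph : Prop :=
  [/\ forall d, src d != tgt d,
      connected edges
    & #|vertex G| + #|faces| = #|edges| + 2].

Definition regular (k : nat) : Prop :=
  forall v, #|[set d | src d == v]| = k.

Definition disconnecting (S : {set {set dart G}}) : Prop :=
  S \subset edges /\ ~ connected (edges :\: S).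

Definition has_mincut (k : nat) : Prop :=
  (exists2 S, disconnecting S & #|S| = k) /\
  (forall S, disconnecting S -> k <= #|S|).

(* An oriented subgraph is given by its set of arcs [T]. *)
Implicit Type T : {set dart G}.

Definition edges_of T : {set {set dart G}} := [set edge d | d in T].

Definition oriented_tree (root : vertex G) T : Prop :=
  [/\ forall d, d \in T -> opp d \notin T,
      spanning_tree (edges_of T)
    & forall u, connect (fun v w => [exists d in T, (src d == v) && (tgt d == w)])
                  u root].

(* The darts of [s] are distinct, have the same source, and are met in the
   order of [s] when turning once clockwise around it. *)
Definition clockwise (s : seq (dart G)) : Prop :=
  if s is d :: _ then subseq s (orbit cw d) else True.

(* [e1] is the first root-edge, oriented away from the root-vertex [src e1].
   Indices start from 0: [root_dart i] is the root-edge number [i + 1], and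
   in a family [T] the component [T i] is the tree number [i + 1]. *)
Variable e1 : dart G.

Definition root_dart (i : nat) : dart G := iter i (@ccw G) e1.

Definition at_root d : bool := (src d == src e1) || (tgt d == src e1).

Definition parents_clockwise n (T : {ffun 'I_n -> {set dart G}}) : Prop :=
  forall v, v != src e1 ->
  forall a : 'I_n -> dart G, (forall i, a i \in T i /\ src (a i) = v) ->
  clockwise [seq a i | i : 'I_n].

Definition regular_decomposition p (T : {ffun 'I_p.*2 -> {set dart G}}) : Prop :=
  [/\ forall i, oriented_tree (src e1) (T i),
      \bigcup_i edges_of (T i) = edges,
      forall d, ~~ at_root d ->
        #|[set i | edge d \in edges_of (T i)]| = 2 /\
        (exists i j, d \in T i /\ opp d \in T j),
      forall i j : 'I_p.*2,
        (edge (root_dart i) \in edges_of (T j)) = (j == i)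
    & parents_clockwise T].

Definition even_regular_decomposition p
    (T : {ffun 'I_p.*2 -> {set dart G}}) : Prop :=
  regular_decomposition T /\
  forall d (i j : 'I_p.*2), ~~ at_root d -> i != j ->
    edge d \in edges_of (T i) -> edge d \in edges_of (T j) -> odd i != odd j.

(* [black f] tells whether the face [f] is black; values outside [faces] are
   irrelevant.  The face between the last root-edge and the first one, which is
   the first root-face, lies on the right of [e1] and is required to be black. *)
Definition face_coloring (black : pred {set dart G}) : Prop :=
  (forall d, black (left_face d) != black (right_face d)) /\
  black (right_face e1).

(* The root-edges with odd number e_1, e_3, ..., e_(2p-1). *)
Definition odd_root_edges p : {set {set dart G}} :=
  [set edge (root_dart i.*2) | i : 'I_p].

Definition reduced_regular_decomposition (black : pred {set dart G}) p
    (T : {ffun 'I_p -> {set dart G}}) : Prop :=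
  [/\ forall i, oriented_tree (src e1) (T i),
      \bigcup_i edges_of (T i) = edges :\: odd_root_edges p /\
      (forall i j, i != j -> [disjoint edges_of (T i) & edges_of (T j)]),
      forall i d, d \in T i -> black (right_face d),
      forall (i : 'I_p) (k : 'I_p.*2),
        (edge (root_dart k) \in edges_of (T i)) = (k == i.*2.+1 :> nat)
    & parents_clockwise T].

End Graph.

Lemma ltn_Sdouble_ord p (j : 'I_p) : j.*2.+1 < p.*2.
Proof. by rewrite ltn_Sdouble. Qed.

(* The tree number 2(j + 1) has index 2j + 1. *)
Definition Lambda (G : rotation_system) p (T : {ffun 'I_p.*2 -> {set dart G}}) :
    {ffun 'I_p -> {set dart G}} :=
  [ffun j => T (Ordinal (ltn_Sdouble_ord j))].

(* Main.v *)
(* Colour a dart by the face on its right: each edge has one black-right dart and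
   the two colours alternate around every vertex.  In an even regular
   decomposition the tree arcs leaving a non-root vertex exhaust its darts, so
   their colour alternates with the index; evenness propagates the phase from
   vertex to vertex, and the root-edges fix it: the arcs of T_2, T_4, ... are
   exactly the black-right ones.  Each odd tree is recovered by rotating the next
   even tree by one dart, whence injectivity.

   Conversely, a reduced decomposition labels all darts leaving non-root vertices
   cyclically by 1, ..., 2p, and one must show that every odd label class is a
   tree containing the right root-edge.
   - If an odd class i contained a directed cycle, planarity would provide a
     potential on faces jumping exactly across the cycle; the vertices around the
     faces where it is extremal would be closed under the arcs of T_(i+1) (for the
     maximum) or T_(i-1) (for the minimum) and avoid the root, which is absurd for
     a tree.
   - Along the boundary of a face the labels drop by a total that is a positive
     multiple of 2p when the face avoids the root.  Summed over all faces, Euler's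
     formula leaves no room for any drop along the 2p root-faces, so that
     consecutive root-edges carry consecutive labels.

   The code numbers trees and root-edges from 0, which exchanges the two parities:
   the trees T_2, T_4, ... have odd indices. *)
Require Import Defs.
From mathcomp Require Import all_boot.
From mathcomp Require Import order ssralg ssrnum zmodp rat matrix mxalgebra zify.
From mathcomp Require Import functions.

Set Implicit Arguments.
Unset Strict Implicit.
Unset Printing Implicit Defensive.

(** * Darts and oriented trees *)

Section Darts.
Variable G : rotation_system.
Implicit Types (d : dart G) (u v : vertex G) (E : {set {set dart G}}).
Implicit Types T : {set dart G}.

Lemma opp_inj : injective (@opp G).
Proof. exact: can_inj (@oppK G). Qed.

Lemma tgt_opp d : tgt (opp d) = src d.
Proof. by rewrite /tgt oppK. Qed.

Lemma edge_opp d : edge (opp d) = edge d.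
Proof. by apply/setP => x; rewrite !inE oppK orbC. Qed.

Lemma edge_eq d d' : (edge d == edge d') = (d' == d) || (d' == opp d).
Proof.
apply/eqP/orP => [e|[] /eqP ->]; rewrite ?edge_opp //.
have: d' \in edge d by rewrite e !inE eqxx.
by rewrite !inE => /orP.
Qed.

Lemma edge_in_edges d : edge d \in edges G.
Proof. exact: imset_f. Qed.

Lemma mem_edges_of T d :
  (edge d \in edges_of T) = (d \in T) || (opp d \in T).
Proof.
apply/imsetP/orP => [[x xT /eqP]|[] xT].
- by rewrite edge_eq => /orP[] /eqP e; [left|right]; rewrite -e.
- by exists d.
- by exists (opp d) => //; rewrite edge_opp.
Qed.

Lemma adj_edge E d : edge d \in E -> adj E (src d) (tgt d).
Proof. by move=> dE; apply/existsP; exists d; rewrite !eqxx. Qed.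

Lemma adj_sym E : symmetric (adj E).
Proof.
suff sub u v : adj E u v -> adj E v u by move=> u v; apply/idP/idP; apply: sub.
case/existsP=> d /and3P[/eqP <- /eqP <- dE]; apply/existsP; exists (opp d).
by rewrite tgt_opp edge_opp dE !eqxx.
Qed.

Lemma connect_adj_sym E : connect_sym (adj E).
Proof. exact/sym_connect_sym/adj_sym. Qed.

Lemma cwK : cancel (@cw G) (@ccw G).
Proof. exact/f_finv/ccw_inj. Qed.

Lemma ccwK : cancel (@ccw G) (@cw G).
Proof. exact/finv_f/ccw_inj. Qed.

Lemma cw_inj : injective (@cw G).
Proof. exact: can_inj cwK. Qed.

Lemma eq_src d d' : (src d == src d') = fconnect (@cw G) d d'.
Proof. by rewrite src_ccw -(same_fconnect_finv (@ccw_inj G)). Qed.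

Lemma src_cw d : src (cw d) = src d.
Proof. by apply/eqP; rewrite eq_sym eq_src fconnect1. Qed.

Lemma src_iter_cw n d : src (iter n (@cw G) d) = src d.
Proof. by elim: n => //= n IH; rewrite src_cw. Qed.

Lemma src_iter_ccw n d : src (iter n (@ccw G) d) = src d.
Proof. by elim: n => //= n <-; rewrite -{2}[iter n _ _]ccwK src_cw. Qed.

Lemma order_cw k d : regular G k -> order (@cw G) d = k.
Proof. by move/(_ (src d)) <-; apply: eq_card => x; rewrite !inE eq_sym eq_src. Qed.

Lemma orbit_cw k d : regular G k -> orbit (@cw G) d = traject (@cw G) d k.
Proof. by move=> Gk; rewrite /orbit (order_cw _ Gk). Qed.

Lemma iter_cw_order k d : regular G k -> iter k (@cw G) d = d.
Proof. by move=> Gk; rewrite -{1}(order_cw d Gk) iter_order //; exact: cw_inj. Qed.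

Lemma face_next_opp d : face_next (opp d) = cw d.
Proof. by rewrite /face_next oppK. Qed.

Lemma src_face_next d : src (face_next d) = tgt d.
Proof. exact: src_cw. Qed.

Lemma face_next_inj : injective (@face_next G).
Proof. by move=> d d' /cw_inj/opp_inj. Qed.

Lemma mem_left_face d : d \in left_face d.
Proof. by rewrite inE connect0. Qed.

Lemma left_face_eq d d' : d' \in left_face d -> left_face d' = left_face d.
Proof.
rewrite inE => dd'; apply/setP => x; rewrite !inE.
by rewrite (same_connect (fconnect_sym face_next_inj) dd').
Qed.

Lemma left_face_next d : left_face (face_next d) = left_face d.
Proof. by apply: left_face_eq; rewrite inE fconnect1. Qed.

Lemma right_face_cw d : right_face d = left_face (cw d).
Proof. by rewrite -face_next_opp left_face_next. Qed.

(** Turning clockwise reaches every dart at a vertex and [opp] crosses an edge, so in a connected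
    graph these two moves reach every dart. *)
Lemma dart_induction (P : dart G -> Prop) d0 :
  connected (edges G) -> P d0 -> (forall d, P d -> P (cw d)) ->
  (forall d, P d -> P (opp d)) -> forall d, P d.
Proof.
move=> conG P0 Pcw Popp d.
have at_src x y : src x = src y -> P x -> P y.
  move/eqP; rewrite eq_src => /iter_findex <- Px.
  by elim: (findex _ _ _) => //= n; exact: Pcw.
suff /(_ d erefl): forall x, src x = src d -> P x by [].
case/connectP: (conG (src d0) (src d)) => q.
have: forall x, src x = src d0 -> P x by move=> x e; apply: at_src P0.
elim: q (src d0) => /= [|v q IH] u Pu; first by move=> _ ->.
case/andP=> /existsP[a /and3P[/eqP au /eqP av _]]; apply: IH => x xv.
by apply: (at_src (opp a)); [rewrite xv -av | apply/Popp/Pu].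
Qed.

End Darts.

(** * Bridges, cycles and trees oriented toward a root *)

Section Trees.
Variable G : rotation_system.
Implicit Types (d : dart G) (u v : vertex G) (E : {set {set dart G}}).
Implicit Types T : {set dart G}.

(** A path joining the ends of [d] without its edge, once shortened to a simple path, would close
    with [d] into a cycle. *)
Lemma acyclic_bridge E d : ~ (exists c, is_cycle E c) -> edge d \in E ->
  ~~ connect (adj (E :\ edge d)) (tgt d) (src d).
Proof.
move=> acE dE; apply/negP => /connectP[q0 /shortenP[q pq uq _] lq]; apply: acE.
suff [c [pc cE tc sc uc]] : exists c,
    [/\ path (fun x y => tgt x == src y) d c,
        all (fun x => edge x \in E :\ edge d) c,
        map (@tgt G) c = q, map (@src G) c = belast (tgt d) q
      & uniq (map (@edge G) c)].
  exists (d :: c); split=> //=.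
  - rewrite rcons_path pc /= -[tgt _](last_map (@tgt G)) tc lq; exact: eqxx.
  - by rewrite dE; apply: sub_all cE => x; case/setD1P.
  - by move: uq; rewrite lastI -lq rcons_uniq sc.
  - rewrite uc andbT; apply/mapP => -[x xc e]; move/allP: cE => /(_ x xc).
    by rewrite -e !inE eqxx.
(* The deleted edge is generalised apart from [d]: the current dart advances along the path while
   the deleted edge stays the same. *)
elim: q {lq} d {dE}(edge d) pq uq => [|v q IH] d e /=; first by exists [::].
case/andP=> /existsP[a /and3P[/eqP ad /eqP av aE]] pq /andP[dq uq].
have [||c [pc cE tc sc uc]] := IH a e; rewrite ?av //.
exists (a :: c); split; rewrite //= ?ad ?eqxx ?aE ?tc ?sc ?av //.
rewrite uc andbT; apply/mapP => -[x xc /eqP]; rewrite edge_eq => /orP[] /eqP xe.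
  case/negP: dq; rewrite -ad -xe; apply: mem_belast; rewrite -av -sc.
  exact: map_f.
case/negP: dq; rewrite in_cons -ad -tgt_opp -xe -tc.
by rewrite (map_f (@tgt G) xc) orbT.
Qed.

Lemma cycle_nonbridge E c : is_cycle E c ->
  exists2 d, edge d \in E & connect (adj (E :\ edge d)) (tgt d) (src d).
Proof.
case: c => [|d c] [] // _ /= pc /andP[dE cE] _ /andP[dc _]; exists d => //.
move: pc; rewrite rcons_path => /andP[pc /eqP <-].
have {dc} : all (fun x => edge x \in E :\ edge d) c.
  apply/allP => x xc; rewrite !inE (allP cE) // andbT.
  by apply: contraNneq dc => <-; apply: map_f.
elim: c {dE cE} d (edge d) pc => //= a c IH d e /andP[/eqP -> pc] /andP[aE cE].
exact: connect_trans (connect1 (adj_edge aE)) (IH _ _ pc cE).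
Qed.

Local Notation arcs T :=
  (fun v w => [exists d in T, (src d == v) && (tgt d == w)]).

Lemma arcs_arc T d : d \in T -> arcs T (src d) (tgt d).
Proof. by move=> dT; apply/existsP; exists d; rewrite dT !eqxx. Qed.

Lemma connect_arcs_closed T (U : {set vertex G}) u v :
  (forall d, d \in T -> src d \in U -> tgt d \in U) ->
  connect (arcs T) u v -> u \in U -> v \in U.
Proof.
move=> clU /connectP[q pq ->]; elim: q u pq => //= w q IH u.
case/andP=> /existsP[d /and3P[dT /eqP <- /eqP <-]] pq uU.
by apply: IH => //; apply: clU.
Qed.

Section OrientedTree.
Variables (r : vertex G) (T : {set dart G}).
Hypothesis treeT : oriented_tree r T.

Lemma oriented_tree_opp d : d \in T -> opp d \notin T.
Proof. by case: treeT => opT _ _; apply: opT. Qed.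

Lemma oriented_tree_closed (U : {set vertex G}) u :
  (forall d, d \in T -> src d \in U -> tgt d \in U) -> u \in U -> r \in U.
Proof.
by move=> clU; apply: connect_arcs_closed clU _; case: treeT => _ _; apply.
Qed.

Lemma oriented_tree_out v : v != r -> exists2 d, d \in T & src d = v.
Proof.
case: treeT => _ _ /(_ v)/connectP[[|w q] /=]; first by move=> _ ->; rewrite eqxx.
by case/andP=> /existsP[d /and3P[dT /eqP sd _]] _ _ _; exists d.
Qed.

Lemma tree_edge_avoid d a : d \in T -> a \in T -> a != d ->
  edge a \in edges_of T :\ edge d.
Proof.
move=> dT aT ad; rewrite !inE mem_edges_of aT andbT edge_eq eq_sym negb_or ad /=.
by apply: contraNneq (oriented_tree_opp aT) => <-.
Qed.

Lemma avoid_arc_path d x q : d \in T -> path (arcs T) x q ->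
  (tgt d \notin q) || (src d \notin x :: q) ->
  connect (adj (edges_of T :\ edge d)) x (last x q).
Proof.
move=> dT; elim: q x => //= y q IH x.
case/andP=> /existsP[a /and3P[aT /eqP ax /eqP ay]] pq avoid.
apply: (connect_trans _ (IH y pq _)).
  rewrite -ax -ay; apply/connect1/adj_edge/tree_edge_avoid => //.
  apply/eqP => e; move: avoid; rewrite -e ax ay !inE !eqxx //.
move: avoid; rewrite !inE !negb_or => /orP[/andP[_ ->] // | /and3P[_ -> ->]].
by rewrite orbT.
Qed.

(** The edge of [d] is a bridge, and a simple path leads from [tgt d] to the root without it. Hence
    [src d] can neither be the root nor reach it by another arc to the head of [q]: either would
    bypass the bridge. *)
Lemma tree_path_arc d q : d \in T -> path (arcs T) (src d) q ->
  uniq (src d :: q) -> last (src d) q = r ->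
  src d != r /\ forall a, a \in T -> src a = src d -> tgt a = head r q -> a = d.
Proof.
move=> dT pq uq lq.
have [_ [_ acT] /(_ (tgt d))] := treeT.
case/connectP=> q0 /shortenP[t pt ut _] lt.
have dE : edge d \in edges_of T by rewrite mem_edges_of dT.
have /negP bridge := acyclic_bridge acT dE.
have tr : connect (adj (edges_of T :\ edge d)) (tgt d) r.
  by rewrite lt; apply: avoid_arc_path => //; case/andP: ut => ->.
split=> [|a aT ad aq].
  by apply/eqP => sr; apply: bridge; rewrite sr.
apply/eqP; apply/negPn/negP => nad; apply: bridge.
apply: connect_trans tr _; rewrite connect_adj_sym.
case: q pq uq lq aq => [|y q] /=; first by move=> _ _ <-.
case/andP=> _ pq /andP[dq uq] <- aq.
apply: (@connect_trans _ _ y); last by apply: avoid_arc_path; rewrite ?dq ?orbT.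
by rewrite -ad -aq; apply/connect1/adj_edge/tree_edge_avoid.
Qed.

Lemma oriented_tree_src d : d \in T -> src d != r.
Proof.
move=> dT; have [_ _ /(_ (src d))/connectP[q0 /shortenP[q pq uq _] lq]] := treeT.
by have [] := tree_path_arc dT pq uq (esym lq).
Qed.

(** Both arcs coincide with the first arc of one simple path to the root. *)
Lemma oriented_tree_unique d d' :
  d \in T -> d' \in T -> src d = src d' -> d = d'.
Proof.
move=> dT dT' e.
have [_ _ /(_ (src d))/connectP[q0 /shortenP[[|y q] pq uq _] lq]] := treeT.
  by case/eqP: (oriented_tree_src dT).
have [_ ud] := tree_path_arc dT pq uq (esym lq).
move: (pq) uq lq; rewrite e in pq ud * => pq0 uq lq.
have [_ ud'] := tree_path_arc dT' pq uq (esym lq).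
case/andP: pq => /existsP[a /and3P[aT /eqP sa /eqP ta]] _.
by rewrite -(ud a) // -(ud' a).
Qed.

End OrientedTree.

(** Unique parents leading to the root leave no room for a cycle: removing an arc [d] cuts off the
    vertices whose parent path passes through [src d]. *)
Lemma oriented_tree_of_parents (r : vertex G) T :
  (forall d, d \in T -> opp d \notin T) ->
  (forall d, d \in T -> src d != r) ->
  (forall d d', d \in T -> d' \in T -> src d = src d' -> d = d') ->
  (forall u, connect (arcs T) u r) ->
  oriented_tree r T.
Proof.
move=> opT rT uT cT; split=> //; split=> [u v|[c /cycle_nonbridge[d0]]].
  have to_r w : connect (adj (edges_of T)) w r.
    apply: connect_sub (cT w) => x y /existsP[d /and3P[dT /eqP <- /eqP <-]].
    by apply/connect1/adj_edge; rewrite mem_edges_of dT.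
  by apply: connect_trans (to_r u) _; rewrite connect_adj_sym.
move=> d0T con0.
have [d dT con] : exists2 d, d \in T &
    connect (adj (edges_of T :\ edge d)) (tgt d) (src d).
  move: d0T; rewrite mem_edges_of => /orP[] dT; first by exists d0.
  by exists (opp d0) => //; rewrite tgt_opp connect_adj_sym edge_opp.
pose D := [set x | connect (arcs T) x (src d)].
(* If [tgt d] descended from [src d], then [D] would be closed under arcs and contain the root,
   which no arc leaves. *)
have noD : tgt d \notin D.
  apply: contra (rT d dT) => tD.
  suff : r \in D.
    rewrite inE => /connectP[[|y q] /=]; first by move=> _ ->.
    case/andP=> /existsP[a /and3P[aT /eqP sa _]].
    by case/eqP: (rT a aT).
  apply: connect_arcs_closed (cT (src d)) _; last by rewrite inE.
  move=> a aT; rewrite !inE => /connectP[[|y q] /= pq e].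
    by move: tD; rewrite inE (uT _ _ aT dT (esym e)) .
  case/andP: pq => /existsP[b /and3P[bT /eqP sb /eqP tb]] pq.
  by rewrite -(uT _ _ bT aT sb) tb; apply/connectP; exists q.
(* A walk avoiding the edge of [d] stays in [D]: an arc taken backward leads to a descendant, and an
   arc other than [d] taken forward follows the unique parent path toward [src d]. *)
case/negP: noD.
move: con; rewrite connect_adj_sym => /connectP[q pq ->].
have : src d \in D by rewrite inE.
elim: q (src d) pq => //= y q IH x /andP[/existsP[a]].
case/and3P=> /eqP <- /eqP <- /setD1P[nad]; rewrite mem_edges_of => aT pq sD.
apply: IH => //; case/orP: aT => aT; last first.
  rewrite inE in sD; rewrite inE; apply: connect_trans (connect1 _) sD.
  by have := arcs_arc aT; rewrite tgt_opp.
move: sD; rewrite inE => /connectP[[|z t] /=].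
  by move=> _ /(uT _ _ dT aT) e; rewrite e eqxx in nad.
case/andP=> /existsP[b /and3P[bT /eqP sb /eqP tb]] pt e.
by rewrite inE -(uT _ _ bT aT sb) tb; apply/connectP; exists t.
Qed.

End Trees.

(** * Circulations on a planar drawing *)

Section Potential.
Import GRing.Theory.
Local Open Scope ring_scope.

(** The left kernel lies in the line of constant rows, so the rank is at least [m - 1]. *)
Lemma rank_constant_kernel (F : fieldType) m n (A : 'M[F]_(m, n)) :
  (forall u : 'rV_m, u *m A = 0 -> forall i j, u 0 i = u 0 j) ->
  (m <= (\rank A).+1)%N.
Proof.
move=> constA.
suff: (kermx A <= (const_mx 1 : 'rV[F]_m))%MS.
  by move/mxrankS; rewrite mxrank_ker; have := rank_leq_row (const_mx 1 : 'rV[F]_m); lia.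
apply/row_subP => i; apply/sub_rVP; exists (row i (kermx A) 0 i).
apply/rowP => j; rewrite [RHS]mxE [const_mx _ _ _]mxE mulr1.
by apply: constA; rewrite -row_mul mulmx_ker row0.
Qed.

Variables (G : rotation_system) (o : pred (dart G)).
Implicit Types (d : dart G) (v : vertex G).
Hypothesis planeG : plane_graph G.
Hypothesis o_opp : forall d, o (opp d) = ~~ o d.

Let O := [set d | o d].

Lemma card_oriented : #|O| = #|edges G|.
Proof.
have -> : edges G = [set edge d | d in O].
  apply/setP => e; apply/imsetP/imsetP => -[d dO ->]; last by exists d.
  have [od|od] := boolP (o d); first by exists d; rewrite ?inE.
  by exists (opp d); rewrite ?inE ?o_opp // edge_opp.
rewrite card_in_imset // => d d'; rewrite !inE => od od' /eqP.
by rewrite edge_eq => /orP[] /eqP // e; move: od'; rewrite e o_opp od.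
Qed.

(** A dart leaving [v] is in [O] or is the opposite of a dart of [O] entering [v]; in the second
    case both signs change. *)
Lemma sum_oriented (c : dart G -> rat) v : (forall d, c (opp d) = - c d) ->
  \sum_(d in O) c d * ((src d == v)%:R - (tgt d == v)%:R) =
  \sum_(d | src d == v) c d.
Proof.
move=> c_opp; rewrite [RHS]big_mkcond /= [RHS](bigID (mem O)) /=.
rewrite [X in _ = _ + X](reindex_inj (@opp_inj G)) /=.
rewrite [X in _ = _ + X](eq_bigl (mem O)) => [|d]; last first.
  by rewrite !inE o_opp negbK.
rewrite -big_split; apply: eq_bigr => d _ /=; rewrite c_opp -/(tgt d).
by do 2![case: eqP => _] => /=;
  rewrite ?(subrr, subr0, sub0r, mulr1, mulr0, mulrN1, addr0, add0r).
Qed.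

(** Up to sign, this is the boundary operator from faces to oriented edges, and the transpose of
    [vertexM] is the one from edges to vertices. *)
Let faceM : 'M[rat]_(#|faces G|, #|O|) := \matrix_(i, j)
  ((right_face (enum_val j) == enum_val i)%:R
   - (left_face (enum_val j) == enum_val i)%:R).

Let vertexM : 'M[rat]_(#|vertex G|, #|O|) := \matrix_(i, j)
  ((src (enum_val j) == enum_val i)%:R - (tgt (enum_val j) == enum_val i)%:R).

Let face_value (u : 'rV[rat]_#|faces G|) (d : dart G) :=
  \sum_i u 0 i * (left_face d == enum_val i)%:R.

Lemma face_value_cw u d : face_value u (cw d) = face_value u (opp d).
Proof. by rewrite /face_value -right_face_cw. Qed.

Lemma mul_faceM u j : (u *m faceM) 0 j =
  face_value u (opp (enum_val j)) - face_value u (enum_val j).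
Proof.
rewrite mxE -sumrB; apply: eq_bigr => i _.
by rewrite mxE mulrBr.
Qed.

Lemma rank_faceM : (#|faces G| <= (\rank faceM).+1)%N.
Proof.
have [_ conG _] := planeG.
apply: rank_constant_kernel => u u0 i j.
have valE i0 d : left_face d = enum_val i0 -> face_value u d = u 0 i0.
  move=> di; rewrite /face_value (bigD1 i0) //= di eqxx mulr1 big1 ?addr0 //.
  by move=> k /negPf nk; rewrite (inj_eq enum_val_inj) eq_sym nk mulr0.
have Oeq d : o d -> face_value u (opp d) = face_value u d.
  move=> od; have dO : d \in O by rewrite inE.
  apply/eqP; rewrite -subr_eq0 -(enum_rankK_in dO dO) -mul_faceM u0 mxE.
  exact: eqxx.
have opp_eq d : face_value u (opp d) = face_value u d.
  have [/Oeq //|od] := boolP (o d).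
  by rewrite -{2}[d]oppK [RHS]Oeq ?o_opp.
have [/imsetP[d0 _ ed0] /imsetP[d1 _ ed1]] := (enum_valP i, enum_valP j).
rewrite -(valE i d0) // -(valE j d1) //.
apply: (dart_induction (P := fun d => face_value u d0 = face_value u d) conG) => //.
  by move=> d ->; rewrite face_value_cw.
by move=> d ->.
Qed.

Lemma rank_vertexM : (#|vertex G| <= (\rank vertexM).+1)%N.
Proof.
have [_ conG _] := planeG.
apply: rank_constant_kernel => u u0 i j.
pose f v := u 0 (enum_rank v).
have Oeq d : o d -> f (src d) = f (tgt d).
  move=> od; have dO : d \in O by rewrite inE.
  apply/eqP; rewrite -subr_eq0; move/rowP: u0 => /(_ (enum_rank_in dO d)).
  rewrite !mxE (eq_bigr (fun k => u 0 k * (src d == enum_val k)%:R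
      - u 0 k * (tgt d == enum_val k)%:R)); last first.
    by move=> k _; rewrite mxE enum_rankK_in // mulrBr.
  rewrite sumrB.
  have val v : \sum_k u 0 k * (v == enum_val k)%:R = f v.
    rewrite (bigD1 (enum_rank v)) //= enum_rankK eqxx mulr1 big1 ?addr0 //.
    move=> k; rewrite -[k in k != _]enum_valK (inj_eq enum_rank_inj) eq_sym.
    by move/negPf->; rewrite mulr0.
  by rewrite !val => ->.
have adj_f v w : adj (edges G) v w -> f v = f w.
  case/existsP=> d /and3P[/eqP <- /eqP <- _].
  have [/Oeq //|od] := boolP (o d).
  by have := Oeq (opp d); rewrite o_opp od tgt_opp => /(_ isT) <-.
rewrite -[i]enum_valK -[j]enum_valK -/(f (enum_val i)) -/(f (enum_val j)).
case/connectP: (conG (enum_val i) (enum_val j)) => q.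
by elim: q (enum_val i) => /= [v _ -> //|w q IH v /andP[/adj_f -> pq]]; apply: IH.
Qed.

(** A boundary has no boundary: the right face of a dart is the left face of the next dart
    clockwise, so the sum around a vertex cancels after a shift by one dart. *)
Lemma faceM_vertexM : faceM *m vertexM^T = 0.
Proof.
apply/matrixP => i k; rewrite !mxE.
pose X d : rat := (right_face d == enum_val i)%:R - (left_face d == enum_val i)%:R.
have X_opp d : X (opp d) = - X d by rewrite /X /right_face oppK opprB.
rewrite (eq_bigr (fun j : 'I_#|O| => X (enum_val j) * ((src (enum_val j) ==
   enum_val k)%:R - (tgt (enum_val j) == enum_val k)%:R))); last first.
  by move=> j _; rewrite !mxE.
rewrite -(big_enum_val (fun d => X d * ((src d == enum_val k)%:R
  - (tgt d == enum_val k)%:R))) /= sum_oriented // sumrB.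
rewrite (eq_bigr (fun d => (left_face (cw d) == enum_val i)%:R)); last first.
  by move=> d _; rewrite right_face_cw.
rewrite [X in _ - X](reindex_inj (@cw_inj G)) /=.
by under [X in _ - X]eq_bigl do rewrite src_cw; rewrite subrr.
Qed.

(* A planar drawing has no homology: by Euler's formula the boundaries of faces
   span the space of circulations. *)
Lemma circulation_potential (c : dart G -> rat) :
  (forall d, c (opp d) = - c d) ->
  (forall v, \sum_(d | src d == v) c d = 0) ->
  exists H : dart G -> rat,
    forall d, H (cw d) = H d + c d /\ H (opp d) = H (cw d).
Proof.
move=> c_opp c_div; have [_ _ euler] := planeG.
pose cM : 'rV[rat]_#|O| := \row_j c (enum_val j).
have cM_ker : (cM <= kermx vertexM^T)%MS.
  apply/sub_kermxP/rowP => k; rewrite !mxE -[RHS](c_div (enum_val k)).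
  rewrite -sum_oriented // (big_enum_val (fun d => c d * ((src d == enum_val k)%:R
    - (tgt d == enum_val k)%:R))).
  by apply: eq_bigr => j _; rewrite !mxE.
have faceM_ker : (faceM <= kermx vertexM^T)%MS.
  exact/sub_kermxP/faceM_vertexM.
(* By Euler's formula the circulations have dimension at most [E - V + 1 = F - 1], which the rank of
   [faceM] reaches. *)
have : (kermx vertexM^T <= faceM)%MS.
  rewrite -(geq_leqif (mxrank_leqif_sup faceM_ker)) mxrank_ker mxrank_tr.
  have := (rank_faceM, rank_vertexM, card_oriented, euler).
  by case=> [[[]]]; lia.
move/(submx_trans cM_ker)/submxP => [u cu].
have Oeq d : o d -> face_value u (opp d) = face_value u d + c d.
  move=> od; have dO : d \in O by rewrite inE.
  have /rowP/(_ (enum_rank_in dO d)) := cu.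
  by rewrite mxE mul_faceM enum_rankK_in // => ->; rewrite addrC subrK.
exists (face_value u) => d; rewrite face_value_cw; split=> //.
have [/Oeq //|od] := boolP (o d).
by rewrite -{2}[d]oppK [in RHS]Oeq ?o_opp // c_opp addrNK.
Qed.

End Potential.

(** * From even to reduced decompositions *)

Lemma iter_double (T : Type) (f : T -> T) n x :
  iter n (fun y => f (f y)) x = iter n.*2 f x.
Proof. by elim: n => //= n ->. Qed.

Lemma filter_traject_alternate (T : eqType) (f : T -> T) (b : pred T) n x :
  (forall y, b (f y) = ~~ b y) -> b x ->
  [seq y <- traject f x n.*2 | b y] = traject (fun y => f (f y)) x n.
Proof.
move=> b_f; elim: n x => //= n IH x bx.
by rewrite bx b_f bx /= IH // !b_f bx.
Qed.

Section OrdinalImage.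
Variables (T : eqType) (n : nat) (a : 'I_n -> T).

Lemma nth_image_ord x (k : 'I_n) : nth x [seq a i | i : 'I_n] k = a k.
Proof. by rewrite (nth_map k) ?size_enum_ord // nth_ord_enum. Qed.

Lemma image_ord_traject (f : T -> T) x :
  [seq a i | i : 'I_n] = traject f x n <-> forall i : 'I_n, a i = iter i f x.
Proof.
split=> [e i|ai]; first by rewrite -(nth_image_ord x) e nth_traject.
apply: (@eq_from_nth _ x) => [|k]; rewrite size_image ?card_ord ?size_traject //.
by move=> kn; rewrite (nth_image_ord x (Ordinal kn)) nth_traject // ai.
Qed.

End OrdinalImage.

(** * Clockwise sequences as iterates of the rotation *)

Section Clockwise.
Variables (G : rotation_system) (n : nat) (a : 'I_n -> dart G) (i0 : 'I_n).
Hypothesis i0_0 : i0 = 0 :> nat.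

Lemma clockwise_ordE : clockwise [seq a i | i : 'I_n] =
  subseq [seq a i | i : 'I_n] (orbit (@cw G) (a i0)).
Proof.
have := nth_image_ord a (a i0) i0; have := size_image a 'I_n.
rewrite card_ord i0_0; case: [seq a i | i : 'I_n] => /= [n0|d s _ -> //].
by have := ltn_ord i0; rewrite -[X in _ < X]n0.
Qed.

(** With as many entries as darts around a vertex, a subsequence of the orbit is the whole orbit. *)
Lemma clockwise_ordP : regular G n ->
  clockwise [seq a i | i : 'I_n] <-> forall i, a i = iter i (@cw G) (a i0).
Proof.
move=> Gn; rewrite clockwise_ordE (orbit_cw _ Gn) -image_ord_traject.
split=> [sub|-> //]; apply/eqP.
by rewrite -(size_subseq_leqif sub) size_image card_ord size_traject.
Qed.

(** Keeping one colour leaves every second dart of the orbit, that is [n] darts, so the entries must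
    be all of these. *)
Lemma clockwise_half_ordP (b : pred (dart G)) : regular G n.*2 ->
  (forall d, b (cw d) = ~~ b d) -> (forall i, b (a i)) ->
  clockwise [seq a i | i : 'I_n] <-> forall i, a i = iter i.*2 (@cw G) (a i0).
Proof.
move=> Gn b_cw ba; rewrite clockwise_ordE (orbit_cw _ Gn).
have -> : (forall i, a i = iter i.*2 (@cw G) (a i0)) <->
    [seq a i | i : 'I_n] = traject (fun y => cw (cw y)) (a i0) n.
  by rewrite image_ord_traject; split=> ai i; rewrite ai iter_double.
have half := filter_traject_alternate n b_cw (ba i0).
split=> [sub|->]; last by rewrite -half filter_subseq.
have bs : all b [seq a i | i : 'I_n] by apply/allP => _ /imageP[i _ ->].
have: subseq [seq a i | i : 'I_n] (traject (fun y => cw (cw y)) (a i0) n).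
  by rewrite -half subseq_filter bs.
move=> sub2; apply/eqP.
by rewrite -(size_subseq_leqif sub2) size_image card_ord size_traject.
Qed.

End Clockwise.

(** * Colours of darts and the arcs of even regular decompositions *)

Section Coloring.
Variables (p : nat) (G : rotation_system) (e1 : dart G).
Variable black : pred {set dart G}.
Hypothesis Greg : regular G p.*2.
Hypothesis Gcol : face_coloring e1 black.
Implicit Types (d : dart G) (i j k : 'I_p.*2).

Definition black_right d := black (right_face d).

Lemma black_right_opp d : black_right (opp d) = ~~ black_right d.
Proof.
have [/(_ d) + _] := Gcol.
by rewrite /black_right [right_face (opp d)]/right_face oppK; do 2!case: (black _).
Qed.

Lemma black_right_cw d : black_right (cw d) = ~~ black_right d.
Proof.
have [/(_ (cw d)) + _] := Gcol.
by rewrite /black_right (right_face_cw d); do 2!case: (black _).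
Qed.

Lemma black_right_iter_cw m d :
  black_right (iter m (@cw G) d) = odd m (+) black_right d.
Proof. by elim: m => //= m; rewrite black_right_cw => ->; rewrite addNb. Qed.

Lemma black_right_root_dart m : black_right (root_dart e1 m) = ~~ odd m.
Proof.
elim: m => [|m IH]; first by case: Gcol.
by rewrite -[LHS]negbK -black_right_cw /root_dart /= ccwK IH.
Qed.

Lemma src_root_dart m : src (root_dart e1 m) = src e1.
Proof. exact: src_iter_ccw. Qed.

Lemma root_dartP d : src d = src e1 -> exists k, d = root_dart e1 k.
Proof.
move/esym/eqP; rewrite src_ccw => con.
have := findex_max con; rewrite -(order_finv (@ccw_inj G)) (order_cw _ Greg).
by move=> lt; exists (Ordinal lt); rewrite /root_dart /= iter_findex.
Qed.

Lemma at_root_edgeP d : at_root e1 d ->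
  exists k, (d = root_dart e1 k) \/ (d = opp (root_dart e1 k)).
Proof.
case/orP=> /eqP /root_dartP [k e]; exists k; first by left.
by right; rewrite -e oppK.
Qed.

Lemma tree_parents n (T : {ffun 'I_n -> {set dart G}}) v :
  (forall i : 'I_n, oriented_tree (src e1) (T i)) -> v != src e1 ->
  exists a : 'I_n -> dart G, forall i : 'I_n, a i \in T i /\ src (a i) = v.
Proof.
move=> treeT nv.
have out (i : 'I_n) : exists d, d \in T i /\ src d = v.
  by have [d] := oriented_tree_out (treeT i) nv; exists d.
by have [a aT] := fin_all_exists out; exists a.
Qed.

Section Forward.
Variable T : {ffun 'I_p.*2 -> {set dart G}}.
Hypothesis regT : regular_decomposition e1 T.

Lemma regular_decomposition_tree i : oriented_tree (src e1) (T i).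
Proof. by case: regT. Qed.
Local Notation treeT := regular_decomposition_tree.

(** The [2p] parent arcs at a non-root vertex are as many as its darts, so they fill its clockwise
    orbit and consecutive trees use consecutive darts. *)
Lemma regular_decomposition_cw i j d :
  j = i.+1 :> nat -> d \in T i -> cw d \in T j.
Proof.
move=> ji dT; set v := src d; have nv : v != src e1 := oriented_tree_src (treeT i) dT.
have [a aT] := tree_parents treeT nv.
have n0 : 0 < p.*2 by apply: leq_ltn_trans (ltn_ord i).
have /(clockwise_ordP a (i0 := Ordinal n0) erefl Greg) ai :
  clockwise [seq a i | i : 'I_p.*2] by case: regT => _ _ _ _ /(_ v nv a aT).
have [aTi sai] := aT i; have [aTj _] := aT j.
by rewrite -(oriented_tree_unique (treeT i) aTi dT sai) ai -iterS -ji -ai.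
Qed.

Lemma regular_decomposition_root i k :
  (opp (root_dart e1 k) \in T i) = (i == k).
Proof.
case: regT => _ _ _ <- _; rewrite mem_edges_of orb_idl // => /(oriented_tree_src (treeT i)).
by rewrite src_root_dart eqxx.
Qed.

Lemma regular_decomposition_color (i0 : 'I_p.*2) i b d :
  i0 = 0 :> nat -> b \in T i0 -> d \in T i -> src d = src b ->
  black_right d = odd i (+) black_right b.
Proof.
move=> i00 bT; case: i => m; elim: m d => [|m IH] d lt dT sd /=.
  congr black_right; apply: (oriented_tree_unique (treeT i0)) => //.
  by rewrite (_ : i0 = Ordinal lt) //; apply: val_inj.
have nv := oriented_tree_src (treeT _) dT.
have [c cT sc] := oriented_tree_out (treeT (Ordinal (ltnW lt))) nv.
have ccT : cw c \in T (Ordinal lt) by apply: regular_decomposition_cw cT.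
rewrite (oriented_tree_unique (treeT _) dT ccT) ?src_cw ?sc //.
by rewrite black_right_cw (IH _ _ cT) ?sc //= addNb.
Qed.

(** Colours at a vertex are fixed by the arc of tree 0 leaving it. That arc has a white face on its
    right, by induction along tree 0 toward the root. *)
Lemma even_regular_decomposition_color i d :
  even_regular_decomposition e1 T -> d \in T i -> black_right d = odd i.
Proof.
move=> [_ evenT] dT.
have n0 : 0 < p.*2 by rewrite -(order_cw d Greg) order_gt0.
pose i0 := Ordinal n0.
have nv := oriented_tree_src (treeT _) dT.
have [b bT sb] := oriented_tree_out (treeT i0) nv.
rewrite (regular_decomposition_color (i0 := i0) _ bT dT) //.
suff /negPf -> : ~~ black_right b by rewrite addbF.
move: bT {sb nv dT d i}.
have [_ _ /(_ (src b))/connectP[q]] := treeT i0.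
elim: q b => /= [|v q IH] b pq lq bT.
  by have := oriented_tree_src (treeT _) bT; rewrite -lq eqxx.
case/andP: pq => /existsP[a /and3P[aT /eqP sa /eqP ta]] pq.
have e : a = b := oriented_tree_unique (treeT i0) aT bT sa.
rewrite {}e {a aT sa} in ta; have [vr|nvr] := eqVneq v (src e1).
  (* An arc of tree 0 entering the root is the reverse of root-edge 0, whose right face is black. *)
  have [|k bk] := @root_dartP (opp b); first by rewrite -vr -ta.
  move: bT; rewrite -[b]oppK bk regular_decomposition_root => /eqP <-.
  by rewrite black_right_opp black_right_root_dart.
have nb : ~~ at_root e1 b.
  by rewrite /at_root ta (negPf nvr) orbF (oriented_tree_src (treeT _) bT).
have [_ _ /(_ _ nb)[_ [_ [j [_ bj]]]] _ _] := regT.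
have [c cT sc] := oriented_tree_out (treeT i0) nvr.
have i0j : i0 != j.
  by apply: contraNneq (oriented_tree_opp (treeT i0) bT) => ->.
(* Evenness makes [j] odd, so [opp b] and the arc [c] of tree 0 leaving the same vertex have
   different colours. *)
have := evenT b i0 j nb i0j; rewrite !mem_edges_of bT bj orbT /= => /(_ isT isT).
move=> oddj; have := regular_decomposition_color (i0 := i0) erefl cT bj.
rewrite sc -ta => /(_ erefl); rewrite black_right_opp => ->.
have := IH c; rewrite sc => /(_ pq lq cT) /negPf ->.
by move: oddj; rewrite addbF; case: odd.
Qed.

End Forward.

(** One clockwise turn carries the arcs of a tree to those of the next tree, so a tree is determined
    by its successor. *)
Lemma regular_decomposition_prev (T U : {ffun 'I_p.*2 -> {set dart G}}) i j d :
  regular_decomposition e1 T -> regular_decomposition e1 U ->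
  j = i.+1 :> nat -> T j = U j -> d \in T i -> d \in U i.
Proof.
move=> regT regU ji TU dT.
have nv := oriented_tree_src (regular_decomposition_tree regT i) dT.
have [c cU sc] := oriented_tree_out (regular_decomposition_tree regU i) nv.
have cdT := regular_decomposition_cw regT ji dT.
have ccU := regular_decomposition_cw regU ji cU.
rewrite TU in cdT; suff -> : d = c by [].
apply/cw_inj/(oriented_tree_unique (regular_decomposition_tree regU j)) => //.
by rewrite !src_cw sc.
Qed.

Lemma Lambda_injective (T U : {ffun 'I_p.*2 -> {set dart G}}) :
  regular_decomposition e1 T -> regular_decomposition e1 U ->
  Lambda T = Lambda U -> T = U.
Proof.
move=> regT regU /ffunP TU.
have TUodd j : odd j -> T j = U j.
  move=> oddj; have lt : j./2 < p by have := ltn_ord j; lia.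
  have := TU (Ordinal lt); rewrite !ffunE.
  suff -> : Ordinal (ltn_Sdouble_ord (Ordinal lt)) = j by [].
  by apply/val_inj => /=; lia.
apply/ffunP => i; have [/TUodd //|eveni] := boolP (odd i).
(* Since [2p] is even, the successor of an even index is again an index. *)
have lt : i.+1 < p.*2 by have := ltn_ord i; lia.
have e : T (Ordinal lt) = U (Ordinal lt) by apply: TUodd.
apply/setP => d; apply/idP/idP.
  exact: (@regular_decomposition_prev T U i (Ordinal lt) d regT regU erefl e).
exact: (@regular_decomposition_prev U T i (Ordinal lt) d regU regT erefl (esym e)).
Qed.

Lemma Lambda_reduced (T : {ffun 'I_p.*2 -> {set dart G}}) :
  0 < p -> even_regular_decomposition e1 T ->
  reduced_regular_decomposition e1 black (Lambda T).
Proof.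
move=> p0 evT; have [regT evenT] := evT; have treeT := regular_decomposition_tree regT.
pose s (j : 'I_p) := Ordinal (ltn_Sdouble_ord j).
have LE (j : 'I_p) : Lambda T j = T (s j) by rewrite ffunE.
have color i d := @even_regular_decomposition_color T regT i d evT.
have root i k : (edge (root_dart e1 k) \in edges_of (T i)) = (i == k).
  by case: regT => _ _ _ -> _.
have s_odd i : odd i -> exists l, i = s l.
  move=> oddi; have lt : i./2 < p by have := ltn_ord i; lia.
  by exists (Ordinal lt); apply/val_inj => /=; lia.
have at_rootE d : at_root e1 d -> exists k, edge d = edge (root_dart e1 k).
  by case/at_root_edgeP=> k [] ->; exists k; rewrite ?edge_opp.
split=> [j||j d|j k|v nv a aT].
- by rewrite LE.
- split=> [|i j nij].
    apply/setP => e; apply/bigcupP/setDP => [[j _]|[/imsetP[d _ ->] dodd]].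
      rewrite LE => eT; have [d _ de] : exists2 d, d \in T (s j) & e = edge d.
        by case/imsetP: eT => d; exists d.
      rewrite {}de in eT *; split; first exact: edge_in_edges.
      apply/imsetP => -[i _ ei]; move: eT.
      have lt : i.*2 < p.*2 by rewrite ltn_double.
      rewrite ei (root _ (Ordinal lt)) => /eqP/(congr1 val) /=; lia.
    have [/at_rootE[k ek]|nroot] := boolP (at_root e1 d).
      have [/s_odd[j kj]|evk] := boolP (odd k).
        by exists j; rewrite // LE ek root kj.
      case/negP: dodd; have lt : k./2 < p by have := ltn_ord k; lia.
      apply/imsetP; exists (Ordinal lt) => //=.
      by rewrite ek; congr (edge (root_dart e1 _)); lia.
    (* The two arcs on an edge away from the root have opposite colours, hence indices of opposite
       parity, and [Lambda] keeps the odd one. *)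
    have [_ _ /(_ _ nroot)[_ [i [j [dT odT]]]] _ _] := regT.
    have := color _ _ odT; rewrite black_right_opp (color _ _ dT) => ij.
    have [/s_odd[k ik]|ni] := boolP (odd i); first exists k => //.
      by rewrite LE mem_edges_of -ik dT.
    have [k jk] : exists l, j = s l by apply: s_odd; rewrite -ij.
    by exists k => //; rewrite LE mem_edges_of -jk odT orbT.
  apply/pred0P => e /=; apply/negP => /andP[/imsetP[d dT ->]].
  have {dT} : edge d \in edges_of (Lambda T i) by rewrite mem_edges_of dT.
  have nsij : s i != s j.
    by apply: contra_neq nij => /(congr1 val)/= ij; apply/val_inj => /=; lia.
  rewrite !LE; have [/at_rootE[k ->]|nroot iT jT] := boolP (at_root e1 d).
    by rewrite !root => /eqP <- /eqP /esym/eqP; rewrite (negPf nsij).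
  by have := evenT d _ _ nroot nsij iT jT; rewrite /= !odd_double.
- by rewrite LE => dT; have := color _ _ dT; rewrite /= odd_double.
- by rewrite LE root eq_sym -val_eqE.
apply/(clockwise_half_ordP (i0 := Ordinal p0) erefl Greg (b := black_right)).
- exact: black_right_cw.
- move=> i; have [+ _] := aT i; rewrite LE => aTi.
  by rewrite (color _ _ aTi) /= odd_double.
case; elim=> [|m IH] lt; first by congr a; apply: val_inj.
have [+ sm] := aT (Ordinal (ltnW lt)); rewrite LE => aTm.
have [+ sm1] := aT (Ordinal lt); rewrite LE => aTm1.
(* The arcs of indices [2m + 1] and [2m + 3] are two turns apart, through the tree of index
   [2m + 2]. *)
have ltm : m.*2.+2 < p.*2 by rewrite -doubleS ltn_double.
have c1 := regular_decomposition_cw regT (i := s (Ordinal (ltnW lt)))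
  (j := Ordinal ltm) erefl aTm.
have c2 := regular_decomposition_cw regT (i := Ordinal ltm)
  (j := s (Ordinal lt)) erefl c1.
rewrite (oriented_tree_unique (treeT _) aTm1 c2) ?src_cw ?sm //.
by rewrite IH.
Qed.

End Coloring.

(** * Labels of a reduced decomposition *)

Section Labels.
Variables (p : nat) (G : rotation_system) (e1 : dart G).
Variable black : pred {set dart G}.
Hypothesis p_gt0 : 0 < p.
Hypothesis Greg : regular G p.*2.
Hypothesis Gcol : face_coloring e1 black.
Variable T : {ffun 'I_p -> {set dart G}}.
Hypothesis redT : reduced_regular_decomposition e1 black T.
Implicit Types (d : dart G) (v : vertex G) (i j : 'I_p).
Local Notation black_right := (black_right black).

Lemma reduced_tree i : oriented_tree (src e1) (T i).
Proof. by case: redT. Qed.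

Lemma reduced_black i d : d \in T i -> black_right d.
Proof. by case: redT => _ _ + _ _; apply. Qed.

(** The label is the index that the tree through the dart is to have in the even decomposition;
    darts leaving the root are left free. *)
Definition is_label (L : dart G -> nat) := forall d, src d != src e1 ->
  [/\ L d < p.*2, odd (L d) = black_right d,
      L (cw d) = (if (L d).+1 == p.*2 then 0 else (L d).+1)
    & forall i, (d \in T i) = (L d == i.*2.+1)].

Lemma label_ex : exists L, is_label L.
Proof.
pose i0 := Ordinal p_gt0.
pose f v := odflt e1 [pick d in T i0 | src d == v].
pose pos d := findex (@cw G) (f (src d)) d.
(* [pos] counts the clockwise turns from the arc of the first tree, which must get label 1; hence
   the shift by one modulo [2p]. *)
exists (fun d => if (pos d).+1 == p.*2 then 0 else (pos d).+1) => d nv.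
have [a aT] := tree_parents reduced_tree nv.
have ablack i : black_right (a i) by apply: (@reduced_black i); case: (aT i).
have /(clockwise_half_ordP (i0 := i0) erefl Greg (black_right_cw Gcol) ablack) ai :
  clockwise [seq a i | i : 'I_p] by case: redT => _ _ _ _ /(_ _ nv a aT).
have [aT0 sa] := aT i0.
have fd : f (src d) = a i0.
  rewrite /f; case: pickP => [b /andP[bT /eqP sb]|/(_ (a i0))] /=.
    by apply: (oriented_tree_unique (reduced_tree i0)); rewrite ?sb.
  by rewrite aT0 sa eqxx.
have con : fconnect (@cw G) (a i0) d by rewrite -eq_src sa.
have pos_lt : pos d < p.*2 by rewrite /pos fd -(order_cw (a i0) Greg) findex_max.
have pos_iter : iter (pos d) (@cw G) (a i0) = d by rewrite /pos fd iter_findex.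
have iter_pos m : m < p.*2 -> iter m (@cw G) (a i0) = d -> pos d = m.
  by move=> lt e; rewrite /pos fd -e findex_iter // (order_cw _ Greg).
have pos_cw : pos (cw d) = (if (pos d).+1 == p.*2 then 0 else (pos d).+1).
  rewrite {1}/pos src_cw fd -{1}pos_iter -iterS; case: eqP => [->|ne].
    by rewrite (iter_cw_order _ Greg) findex0.
  by rewrite findex_iter // (order_cw _ Greg); lia.
have black_pos : black_right d = ~~ odd (pos d).
  by rewrite -{1}pos_iter (black_right_iter_cw Gcol) ablack addbT.
split=> [|||i].
- by case: eqP; lia.
- by rewrite black_pos; case: eqP => //; lia.
- by rewrite pos_cw; case: eqP => //=; case: eqP; lia.
apply/idP/idP => [dT|/eqP Ld].
  have [aTi sai] := aT i.
  have := oriented_tree_unique (reduced_tree i) aTi dT sai.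
  rewrite ai => /iter_pos -> //; last by rewrite ltn_double.
  by rewrite ifF //; apply/negP => /eqP; lia.
have [+ _] := aT i; rewrite ai (_ : i.*2 = pos d) ?pos_iter //.
by move: Ld; case: eqP => //; lia.
Qed.

Variable L : dart G -> nat.
Hypothesis LP : is_label L.

Lemma label_lt d : src d != src e1 -> L d < p.*2.
Proof. by case/LP. Qed.

Lemma label_odd d : src d != src e1 -> odd (L d) = black_right d.
Proof. by case/LP. Qed.

Lemma label_cw d : src d != src e1 ->
  L (cw d) = (if (L d).+1 == p.*2 then 0 else (L d).+1).
Proof. by case/LP. Qed.

Lemma mem_label i d : (d \in T i) = (src d != src e1) && (L d == i.*2.+1).
Proof.
have [sd|/LP[_ _ _ ->] //] := eqVneq.
by apply/negP => /(oriented_tree_src (reduced_tree i)); rewrite sd eqxx.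
Qed.

(** Odd labels mark arcs of a given tree, which are unique; one clockwise turn reduces even labels
    to odd ones, without wrap-around because [2p] is even. *)
Lemma label_unique d d' :
  src d != src e1 -> src d = src d' -> L d = L d' -> d = d'.
Proof.
suff odd_unique x y : src x != src e1 -> src x = src y -> L x = L y ->
    odd (L x) -> x = y.
  move=> nv sd Ld; have nv' : src d' != src e1 by rewrite -sd.
  have [|evd] := boolP (odd (L d)); first exact: odd_unique.
  apply/cw_inj/odd_unique; rewrite ?src_cw // ?label_cw -?Ld //.
  by have := label_lt nv; case: eqP => //; lia.
move=> nv sd Ld oddx; have ltx := label_lt nv.
have lt : (L x)./2 < p by lia.
apply: (oriented_tree_unique (reduced_tree (Ordinal lt))) => //.
  by rewrite mem_label nv /=; lia.
by rewrite mem_label -sd nv -Ld /=; lia.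
Qed.

Lemma label_exists v k : v != src e1 -> k < p.*2 ->
  exists2 d, src d = v & L d = k.
Proof.
move=> nv; pose i0 := Ordinal p_gt0.
have [d0 d0T sd0] := oriented_tree_out (reduced_tree i0) nv.
elim: k => [|k IH] lt.
  (* The arc of the first tree has label 1, so the dart just counterclockwise from it has label
     0. *)
  have nv' : src (ccw d0) != src e1 by rewrite -(src_cw (ccw d0)) ccwK sd0.
  exists (ccw d0); first by rewrite -(src_cw (ccw d0)) ccwK.
  have := label_cw nv'; rewrite ccwK; move: d0T; rewrite mem_label => /andP[_ /eqP ->].
  by case: eqP => //=; lia.
have [d sd Ld] := IH (ltnW lt); exists (cw d); rewrite ?src_cw //.
by rewrite label_cw ?sd // Ld ifF //; apply/negP => /eqP; lia.
Qed.

(** An odd class is one of the given trees. Contradictions below come from nonempty sets closed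
    under such a class and avoiding the root. *)
Lemma odd_label_closed k (U : {set vertex G}) u : odd k -> k < p.*2 ->
  (forall d, src d != src e1 -> L d = k -> src d \in U -> tgt d \in U) ->
  u \in U -> src e1 \in U.
Proof.
move=> oddk ltk clU; have lt : k./2 < p by lia.
apply: (oriented_tree_closed (reduced_tree (Ordinal lt))) => d.
by rewrite mem_label => /andP[nv /eqP Ld]; apply: clU => //; rewrite Ld /=; lia.
Qed.

End Labels.

(** * Every vertex reaches the root along each white label class *)

Section EvenLabels.
Import Order.TTheory GRing.Theory Num.Theory.
Local Open Scope ring_scope.
Variables (p : nat) (G : rotation_system) (e1 : dart G).
Variable black : pred {set dart G}.
Hypothesis p_gt0 : (0 < p)%N.
Hypothesis planeG : plane_graph G.
Hypothesis Greg : regular G p.*2.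
Hypothesis Gcol : face_coloring e1 black.
Variable T : {ffun 'I_p -> {set dart G}}.
Hypothesis redT : reduced_regular_decomposition e1 black T.
Variable L : dart G -> nat.
Hypothesis LP : is_label e1 black T L.
Implicit Types (d : dart G) (u v : vertex G).
Local Notation r := (src e1).
Local Notation black_right := (black_right black).

Variable k : nat.
Hypothesis evk : ~~ odd k.
Hypothesis ltk : (k < p.*2)%N.

Let A := [set d | (src d != r) && (L d == k)].
(** The default [e1] occurs only at the root, which no dart of [A] leaves. *)
Let par v := odflt e1 [pick d in A | src d == v].
Let f v := tgt (par v).

Lemma parentP v : v != r -> par v \in A /\ src (par v) = v.
Proof.
move=> nv; rewrite /par; case: pickP => [d /andP[dA /eqP sd] //|].
have [d sd Ld] := label_exists p_gt0 redT LP nv ltk.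
by move=> /(_ d); rewrite inE Ld sd nv !eqxx.
Qed.

Lemma parent_unique d : d \in A -> d = par (src d).
Proof.
rewrite inE => /andP[nv /eqP Ld]; have [+ sp] := parentP nv.
by rewrite inE => /andP[_ /eqP Lp]; apply: (label_unique p_gt0 redT LP); rewrite ?sp ?Lp.
Qed.

Lemma class_opp d : d \in A -> opp d \notin A.
Proof.
rewrite !inE => /andP[nv /eqP Ld]; apply/negP => /andP[nv' /eqP Ld'].
have := label_odd LP nv; have := label_odd LP nv'.
by rewrite Ld Ld' (black_right_opp Gcol) => ->; case: (black_right d).
Qed.

(** * Vertices permuted by the parent map away from the root *)

Section Trap.
Variable Z : {set vertex G}.
Hypothesis Z0 : Z != set0.
Hypothesis rZ : r \notin Z.
Hypothesis fZ : f @: Z = Z.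

Lemma trap_nonroot v : v \in Z -> v != r.
Proof. by apply: contraTneq => ->. Qed.

Let AZ := [set d in A | src d \in Z].

Lemma trap_inj : {in Z &, injective f}.
Proof. by apply/imset_injP; rewrite fZ. Qed.

Lemma tgt_trap_arc d : d \in AZ -> tgt d = f (src d).
Proof. by case/setIdP=> dA _; rewrite /f -parent_unique. Qed.

Lemma tgt_trap_mem d : d \in AZ -> tgt d \in Z.
Proof. by move=> dA; rewrite tgt_trap_arc // -fZ imset_f //; case/setIdP: dA. Qed.

(** The unit flow along the directed cycles formed by [AZ], as an antisymmetric function of
    darts. *)
Let c d : rat := (d \in AZ)%:R - (opp d \in AZ)%:R.

Lemma sum_mem_unique (P Q : pred (dart G)) (b : bool) :
  (forall d d', P d -> Q d -> P d' -> Q d' -> d = d') ->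
  (b <-> exists2 d, P d & Q d) -> \sum_(d | P d) (Q d)%:R = b%:R :> rat.
Proof.
move=> PQ_unique; case: b => [[/(_ isT)[d Pd Qd] _]|[_ none]].
  rewrite (bigD1 d) //= Qd big1 ?addr0 // => d' /andP[Pd' nd'].
  by case: (boolP (Q d')) => // Qd'; rewrite (PQ_unique d' d) ?eqxx in nd'.
rewrite big1 // => d Pd; case: (boolP (Q d)) => // Qd.
by have: false by apply: none; exists d.
Qed.

(** Since [f] permutes [Z], each vertex of [Z] has one arc of [AZ] out and one in, and the other
    vertices have none. *)
Lemma circ_div v : \sum_(d | src d == v) c d = 0.
Proof.
rewrite sumrB (sum_mem_unique (b := v \in Z)).
- rewrite (sum_mem_unique (b := v \in Z)) ?subrr //.
    move=> d d' /eqP sd dA /eqP sd' dA'; apply/opp_inj.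
    have [oA _] := setIdP dA; have [oA' _] := setIdP dA'.
    rewrite (parent_unique oA) (parent_unique oA'); congr par; apply: trap_inj.
    - by case/setIdP: dA.
    - by case/setIdP: dA'.
    by rewrite -!tgt_trap_arc // !tgt_opp sd.
  split=> [|[d /eqP <- dA]]; last by rewrite -tgt_opp tgt_trap_mem.
  rewrite -{1}fZ => /imsetP[u uZ ->]; have [pA sp] := parentP (trap_nonroot uZ).
  by exists (opp (par u)) => //; rewrite oppK; apply/setIdP; rewrite sp.
- move=> d d' /eqP sd /setIdP[dA _] /eqP sd' /setIdP[dA' _].
  by rewrite (parent_unique dA) (parent_unique dA') sd sd'.
split=> [vZ|[d /eqP <- /setIdP[]] //]; have [pA sp] := parentP (trap_nonroot vZ).
by exists (par v); rewrite ?sp ?eqxx //; apply/setIdP; rewrite sp.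
Qed.

Lemma circ_opp d : c (opp d) = - c d.
Proof. by rewrite /c oppK opprB. Qed.

Lemma circ_root d : src d = r -> c d = 0.
Proof.
move=> sd; rewrite /c.
have /negPf -> : d \notin AZ by apply: contra rZ => /setIdP[_]; rewrite sd.
have /negPf -> : opp d \notin AZ by apply: contra rZ => /tgt_trap_mem; rewrite tgt_opp sd.
by rewrite subrr.
Qed.

Lemma circ_nonpos d : src d != r -> d != par (src d) -> c d <= 0.
Proof.
move=> nv nd; rewrite /c.
have /negPf -> : d \notin AZ by apply: contra nd => /setIdP[/parent_unique <-].
by rewrite sub0r oppr_le0 ler0n.
Qed.

Lemma circ_parent v : v \in Z -> c (par v) = 1.
Proof.
move=> vZ; have [pA sp] := parentP (trap_nonroot vZ).
have vA : par v \in AZ by apply/setIdP; rewrite sp.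
rewrite /c vA.
have /negPf -> : opp (par v) \notin AZ by apply: contra (class_opp pA) => /setIdP[].
by rewrite subr0.
Qed.

Variable H : dart G -> rat.
Hypothesis HP : forall d, H (cw d) = H d + c d /\ H (opp d) = H (cw d).

Lemma potential_face_next d : H (face_next d) = H d.
Proof. by rewrite /face_next; have [_ <-] := HP (opp d); rewrite oppK. Qed.

(** No flow passes through the root, so turning around it never changes the potential. *)
Lemma potential_root d : src d = r -> H d = H e1.
Proof.
move=> sd; have : fconnect (@cw G) e1 d by rewrite -eq_src sd.
move/iter_findex <-; elim: (findex _ _ _) => //= m <-.
by have [-> _] := HP (iter m (@cw G) e1); rewrite circ_root ?addr0 // src_iter_cw.
Qed.

(* Around a vertex, the potential can only increase across the dart of label [k]. *)
Lemma potential_between d : src d != r ->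
  H (par (src d)) <= H d <= H (cw (par (src d))).
Proof.
move=> nv; set a := par (src d).
have [_ sa] := parentP nv; rewrite -/a in sa.
(* From [cw a] on, each turn crosses a dart other than [a], and such a crossing never raises the
   potential. *)
have step m : (m.+1 < p.*2)%N ->
    H (iter m.+2 (@cw G) a) <= H (iter m.+1 (@cw G) a).
  move=> lt; have [-> _] := HP (iter m.+1 (@cw G) a).
  rewrite gerDl; apply: circ_nonpos; rewrite src_iter_cw ?sa // -/a.
  apply/negP => /eqP e; have: findex (@cw G) a (iter m.+1 (@cw G) a) = m.+1.
    by rewrite findex_iter // (order_cw _ Greg).
  by rewrite e findex0.
have mono m n : (m <= n)%N -> (n < p.*2)%N ->
    H (iter n.+1 (@cw G) a) <= H (iter m.+1 (@cw G) a).
  move/subnK <-; elim: (n - m)%N => //= t IH lt.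
  by apply: le_trans (IH (ltnW lt)); apply: step.
have con : fconnect (@cw G) (cw a) d by rewrite -eq_src src_cw sa.
have := findex_max con; rewrite (order_cw _ Greg).
have := iter_findex con; rewrite -iterSr; set m := findex _ _ _ => ed ltm.
apply/andP; split; last by rewrite -ed; apply: (mono 0%N).
have ea : iter p.*2.-1.+1 (@cw G) a = a.
  by rewrite prednK ?double_gt0 // (iter_cw_order _ Greg).
by rewrite -ed -{1}ea; apply: mono; lia.
Qed.

Lemma potential_nonconstant : exists d, H d != H e1.
Proof.
have /set0Pn[v vZ] := Z0; have [Hcw _] := HP (par v); rewrite circ_parent // in Hcw.
have [e|] := eqVneq (H (par v)) (H e1); last by exists (par v).
exists (cw (par v)); rewrite Hcw e -subr_eq0 addrC addKr; exact: oner_neq0.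
Qed.

Lemma label_succ_par d : src d != r -> L d = k.+1 -> cw (par (src d)) = d.
Proof.
move=> nv Ld; have [+ sp] := parentP nv; rewrite inE => /andP[np /eqP Lp].
apply: (label_unique p_gt0 redT LP); rewrite ?src_cw ?sp // (label_cw LP) // Lp Ld.
by rewrite ifF //; apply/negP => /eqP; lia.
Qed.

Lemma label_pred_par d : src d != r ->
  L d = (if k == 0%N then p.*2.-1 else k.-1) -> cw d = par (src d).
Proof.
move=> nv Ld; have [+ sp] := parentP nv; rewrite inE => /andP[np /eqP Lp].
apply: (label_unique p_gt0 redT LP); rewrite ?src_cw ?sp // (label_cw LP) // Lp Ld.
by do 2!case: eqP; lia.
Qed.

(** The vertices on faces of potential [M] are closed under the tree of label [l]; they would
    include the root, around which the potential is [H e1]. *)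
Lemma extremum_trap (M : rat) (l : nat) : odd l -> (l < p.*2)%N ->
  (exists d, H d = M) -> M != H e1 ->
  (forall d, src d != r -> L d = l -> (exists2 x, src x = src d & H x = M) ->
     H d = M \/ H (opp d) = M) -> False.
Proof.
move=> oddl ltl [d0 Hd0] nM clM.
pose U := [set src d | d in [set d | H d == M]].
suff : r \in U.
  by case/imsetP=> d + /esym/potential_root Hd; rewrite inE Hd eq_sym (negPf nM).
apply: (@odd_label_closed p G e1 black p_gt0 T redT L LP l U (src d0)) => //; last first.
  by apply/imset_f; rewrite inE Hd0.
move=> d nv Ld /imsetP[x]; rewrite inE => /eqP Hx sx.
have [|Hd|Hod] := clM d nv Ld; first by exists x.
  by apply/imsetP; exists (face_next d); rewrite ?src_face_next // inE potential_face_next Hd.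
by apply/imsetP; exists (opp d) => //; rewrite inE Hod.
Qed.

Lemma trap_false : False.
Proof.
have [dM maxH] : exists dM, forall d, H d <= H dM.
  have [x _ mx] := Order.TotalTheory.arg_maxP H (i0 := e1) (P := predT) isT.
  by exists x => d; apply: mx.
have [dm minH] : exists dm, forall d, H dm <= H d.
  have [x _ mx] := Order.TotalTheory.arg_minP H (i0 := e1) (P := predT) isT.
  by exists x => d; apply: mx.
(* The face just clockwise from the parent dart has the largest potential at its vertex, and it lies
   on the left of the dart of label [k + 1]. *)
have [eM|nM] := eqVneq (H dM) (H e1); last first.
  apply: (@extremum_trap (H dM) k.+1) => //; first lia.
  - by exists dM.
  move=> d nv Ld [x sx Hx]; left; apply/eqP; rewrite eq_le maxH //= -Hx.
  have nvx : src x != r by rewrite sx.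
  by rewrite -(label_succ_par nv Ld) -sx; case/andP: (potential_between nvx).
have [em|nm] := eqVneq (H dm) (H e1).
  have [d /eqP] := potential_nonconstant; apply; apply/eqP; rewrite eq_le.
  by rewrite -{1}eM -em maxH ?minH.
(* Symmetrically, the face of smallest potential at a vertex lies on the right of the dart of label
   [k - 1], read as [2p - 1] when [k] is 0. *)
apply: (@extremum_trap (H dm) (if k == 0%N then p.*2.-1 else k.-1)) => //.
- by case: eqP; lia.
- by case: eqP; lia.
- by exists dm.
move=> d nv Ld [x sx Hx]; right; apply/eqP; rewrite eq_le minH // andbT -Hx.
have [_ ->] := HP d; rewrite (label_pred_par nv Ld) -sx.
have nvx : src x != r by rewrite sx.
by case/andP: (potential_between nvx).
Qed.

End Trap.

(** The vertices that never reach the root are stable under the parent map. A minimal nonempty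
    stable set without the root is permuted by it, which planarity rules out. *)
Lemma even_label_connect u :
  connect (fun v w => [exists d in A, (src d == v) && (tgt d == w)]) u r.
Proof.
set e := (fun v w => _); apply/negPn/negP => nu.
pose trapped (Z : {set vertex G}) :=
  [&& Z != set0, r \notin Z & f @: Z \subset Z].
pose U := [set v | ~~ connect e v r].
have trapU : trapped U.
  apply/and3P; split; first by apply/set0Pn; exists u; rewrite inE.
    by rewrite inE connect0.
  apply/subsetP => _ /imsetP[v vU ->]; rewrite inE in vU.
  have nv : v != r by apply: contraNneq vU => ->; apply: connect0.
  have [pA sp] := parentP nv; rewrite inE; apply: contra vU; apply: connect_trans.
  by apply/connect1/existsP; exists (par v); rewrite pA sp /f !eqxx.
have [Z /minsetP[/and3P[Z0 rZ fZ] minZ] _] := minset_exists (P := trapped) trapU.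
have fZZ : f @: Z = Z.
  apply: minZ => //; apply/and3P; split.
  - by have /set0Pn[v vZ] := Z0; apply/set0Pn; exists (f v); apply: imset_f.
  - by apply: contra rZ; apply/subsetP.
  by apply: imsetS.
have [H HP] := circulation_potential planeG (black_right_opp Gcol)
  (circ_opp Z) (circ_div rZ fZZ).
exact: (trap_false Z0 rZ fZZ HP).
Qed.

End EvenLabels.

(** * Labels of the root-edges *)

Section FaceCount.
Variables (p : nat) (G : rotation_system) (e1 : dart G).
Variable black : pred {set dart G}.
Hypothesis p_gt0 : 0 < p.
Hypothesis planeG : plane_graph G.
Hypothesis Greg : regular G p.*2.
Hypothesis Gcol : face_coloring e1 black.
Variable T : {ffun 'I_p -> {set dart G}}.
Hypothesis redT : reduced_regular_decomposition e1 black T.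
Variable L : dart G -> nat.
Hypothesis LP : is_label e1 black T L.
Implicit Types (d : dart G) (u v : vertex G).
Local Notation r := (src e1).

(* The drop of the label along [d], modulo [2p], when following the boundary
   of its left face. *)
Definition drop d := if at_root e1 d then 0 else
  if L (opp d) < L d then (L d - L (opp d)).-1
  else (L d + p.*2 - L (opp d)).-1.

Lemma src_nonroot d : ~~ at_root e1 d -> src d != r.
Proof. by rewrite /at_root negb_or => /andP[]. Qed.

Lemma tgt_nonroot d : ~~ at_root e1 d -> src (opp d) != r.
Proof. by rewrite /at_root negb_or => /andP[]. Qed.

Lemma at_root_opp d : at_root e1 (opp d) = at_root e1 d.
Proof. by rewrite /at_root tgt_opp orbC. Qed.

Lemma label_opp_odd d : ~~ at_root e1 d -> odd (L (opp d)) = ~~ odd (L d).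
Proof.
move=> nd; rewrite (label_odd LP (src_nonroot nd)).
by rewrite (label_odd LP (tgt_nonroot nd)) (black_right_opp Gcol).
Qed.

(** The two label differences modulo [2p] along an edge add up to [2p], and each drop is one
    less. *)
Lemma drop_opp d : drop d + drop (opp d) = if at_root e1 d then 0 else p.*2.-2.
Proof.
rewrite /drop at_root_opp oppK; case: ifPn => // nd.
have := (label_lt LP (src_nonroot nd), label_lt LP (tgt_nonroot nd)).
have : L (opp d) != L d.
  by apply/eqP => e; have := label_opp_odd nd; rewrite e; case: odd.
move=> /eqP ne [l1 l2]; case: ltnP => lt1; case: ltnP => lt2; lia.
Qed.

(** The turn from [opp d] to [face_next d] raises the label by one, the unit taken off in [drop];
    the multiple of [2p] records an increase of the label. *)
Lemma drop_label d : ~~ at_root e1 d ->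
  drop d + L (face_next d) = L d + p.*2 * (L d < L (face_next d)).
Proof.
move=> nd; rewrite /face_next (label_cw LP (tgt_nonroot nd)) /drop (negPf nd).
have := (label_lt LP (src_nonroot nd), label_lt LP (tgt_nonroot nd)).
have : L (opp d) != L d.
  by apply/eqP => e; have := label_opp_odd nd; rewrite e; case: odd.
move=> /eqP ne [l1 l2]; case: eqP => ?; case: (ltnP (L (opp d))) => ?; case: ltnP => ?; lia.
Qed.

Lemma face_next_in_face d x : (face_next x \in left_face d) = (x \in left_face d).
Proof.
apply/idP/idP => /left_face_eq <-; rewrite ?left_face_next ?mem_left_face //.
by rewrite -left_face_next mem_left_face.
Qed.

Lemma face_closed_root d (U := [set src x | x in left_face d]) :
  (forall x, x \in left_face d -> src x != r) -> r \notin U.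
Proof.
move=> nd; apply/negP => /imsetP[x xf /esym/eqP].
by rewrite (negPf (nd x xf)).
Qed.

(* A face without descent would be bounded by a directed cycle of one of the
   given trees, on its own side or on the opposite one. *)
Lemma face_drop d : (forall x, x \in left_face d -> src x != r) ->
  p.*2 <= \sum_(x in left_face d) drop x.
Proof.
move=> nd.
have nroot x : x \in left_face d -> ~~ at_root e1 x.
  move=> xf; rewrite /at_root negb_or nd // -src_face_next nd //.
  by rewrite face_next_in_face.
(* [W] counts the increases of the label around the face. The total drop is [2p] times [W], so only
   [W = 0] has to be excluded. *)
pose W := \sum_(x in left_face d) (L x < L (face_next x)).
have sumL : \sum_(x in left_face d) L (face_next x) = \sum_(x in left_face d) L x.
  rewrite [RHS](reindex_inj (@face_next_inj G)) /=; apply: eq_bigl => x.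
  by rewrite face_next_in_face.
have sumE : \sum_(x in left_face d) drop x = p.*2 * W.
  apply/eqP; rewrite -(eqn_add2r (\sum_(x in left_face d) L (face_next x))).
  rewrite -big_split (eq_bigr _ (fun x xf => drop_label (nroot x xf))) big_split /=.
  by rewrite sumL addnC -big_distrr.
have [W0|] := posnP W; last by rewrite sumE => /(leq_pmulr p.*2).
have drop0 x : x \in left_face d -> drop x = 0.
  move: sumE; rewrite W0 muln0 => /eqP; rewrite sum_nat_eq0 => /forall_inP + xf.
  by move=> /(_ x xf)/eqP.
have L_next x : x \in left_face d -> L (face_next x) = L x.
  move=> xf; have := drop_label (nroot x xf); rewrite drop0 // add0n.
  move/eqP: W0; rewrite sum_nat_eq0 => /forall_inP/(_ x xf)/eqP ->.
  by rewrite muln0 addn0.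
have L_const x : x \in left_face d -> L x = L d.
  rewrite inE => /iter_findex <-; elim: (findex _ _ _) => //= m IH.
  by rewrite L_next // inE fconnect_iter.
have dU : src d \in [set src x | x in left_face d].
  exact/imset_f/mem_left_face.
have ltd := label_lt LP (nd _ (mem_left_face d)).
case/negP: (face_closed_root nd).
have [oddk|evk] := boolP (odd (L d)).
  apply: (odd_label_closed p_gt0 redT LP oddk ltd) dU => y nv Ly /imsetP[x xf sx].
  have -> : y = x by apply: (label_unique p_gt0 redT LP); rewrite ?Ly ?L_const.
  by apply/imsetP; exists (face_next x); rewrite ?src_face_next // face_next_in_face.
(* When the constant label is even, the opposite darts all have the preceding label modulo [2p],
   which is odd: the reversed boundary follows a given tree. *)
pose k := if L d == 0 then p.*2.-1 else (L d).-1.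
have L_opp x : x \in left_face d -> L (opp x) = k.
  move=> xf; have := drop0 x xf; rewrite /drop (negPf (nroot x xf)) /k.
  have := label_lt LP (tgt_nonroot (nroot x xf)); have := L_const x xf.
  have : L (opp x) != L x.
    by apply/eqP => e; have := label_opp_odd (nroot x xf); rewrite e; case: odd.
  by move=> /eqP ? ? ?; case: ltnP => ?; case: eqP => ? ?; lia.
apply: (@odd_label_closed _ _ _ _ p_gt0 _ redT _ LP k _ (src d)) => //.
- by rewrite /k; case: eqP; lia.
- by rewrite /k; case: eqP; lia.
move=> y nv Ly /imsetP[x xf sx]; pose z := opp (ccw x).
have nz : face_next z = x by rewrite face_next_opp ccwK.
have zf : z \in left_face d by rewrite -face_next_in_face nz.
have -> : y = opp z.
  apply: (label_unique p_gt0 redT LP) => //; last by rewrite Ly L_opp.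
  by rewrite sx -nz src_face_next.
by rewrite tgt_opp; apply: imset_f.
Qed.

Lemma card_darts : #|dart G| = p.*2 * #|vertex G|.
Proof.
rewrite -sum1_card (partition_big (@src G) predT) //= mulnC -sum_nat_const.
by apply: eq_bigr => v _; rewrite -(Greg v) -sum1_card; apply: eq_bigl => d; rewrite !inE.
Qed.

Lemma card_darts_edges : #|dart G| = #|edges G|.*2.
Proof.
rewrite -(card_oriented (black_right_opp Gcol)) -addnn.
rewrite -[LHS](cardC (mem [set d | black_right black d])); congr (_ + _).
rewrite -[RHS](card_imset _ (@opp_inj G)); apply: eq_card => d.
rewrite !inE; apply/idP/imsetP => [nd|[x + ->]].
  by exists (opp d); rewrite ?oppK ?inE ?(black_right_opp Gcol).
by rewrite inE (black_right_opp Gcol) negbK.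
Qed.

Lemma card_nonroot_darts : #|[set d | ~~ at_root e1 d]| + p.*2.*2 = #|dart G|.
Proof.
have [loopless _ _] := planeG.
rewrite -(cardsC [set d | at_root e1 d]) addnC; congr (_ + _); last first.
  by apply: eq_card => d; rewrite !inE.
have -> : [set d | at_root e1 d] = [set d | src d == r] :|: [set d | tgt d == r].
  by apply/setP => d; rewrite !inE.
have -> : [set d | tgt d == r] = [set opp d | d in [set d | src d == r]].
  apply/setP => d; rewrite inE; apply/idP/imsetP => [td|[x + ->]].
    by exists (opp d); rewrite ?oppK ?inE.
  by rewrite inE tgt_opp.
rewrite cardsU card_imset ?Greg; last exact: opp_inj.
rewrite addnn (_ : _ :&: _ = set0) ?cards0 ?subn0 //.
apply/setP => d; rewrite !inE; apply/negP => /andP[/eqP sd /imsetP[x + e]].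
rewrite inE => /eqP sx; case/eqP: (loopless d).
by rewrite sd e tgt_opp sx.
Qed.

Lemma sum_drop : (\sum_d drop d).*2 = p.*2.-2 * #|[set d | ~~ at_root e1 d]|.
Proof.
rewrite -addnn {2}(reindex_inj (@opp_inj G)) -big_split /=.
rewrite (eq_bigr _ (fun d _ => drop_opp d)) mulnC -sum_nat_const [RHS]big_mkcond /=.
by apply: eq_bigr => d _; rewrite inE; case: at_root.
Qed.

Let rootF := [set left_face (root_dart e1 k) | k : 'I_p.*2].
Let face_sum f := \sum_(d | left_face d == f) drop d.

(** The edges away from the root contribute [2p - 2] each, in total [2p(p - 1)(V - 2)]. By Euler's
    formula at least [(p - 1)(V - 2)] faces avoid the root, each using at least [2p]. Equality must
    hold throughout. *)
Lemma face_count : #|rootF| = p.*2 /\ \sum_(f in rootF) face_sum f = 0.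
Proof.
have [loopless _ euler] := planeG.
have sumF : \sum_d drop d = \sum_(f in faces G) face_sum f.
  by rewrite (partition_big (@left_face G) (mem (faces G))) //= => d _; apply: imset_f.
have subF : rootF \subset faces G.
  by apply/subsetP => _ /imsetP[k _ ->]; apply: imset_f.
move: sumF; rewrite (big_setID rootF) /= (setIidPr subF).
have : p.*2 * #|faces G :\: rootF| <= \sum_(f in faces G :\: rootF) face_sum f.
  rewrite mulnC -sum_nat_const; apply: leq_sum => f /setDP[/imsetP[d _ ->] nroot].
  rewrite /face_sum (eq_bigl (mem (left_face d))) => [|x] /=; last first.
    apply/eqP/idP => [<-|/left_face_eq //]; exact: mem_left_face.
  apply: face_drop => x /left_face_eq xf; apply: contra nroot => /eqP.
  by case/(root_dartP Greg)=> k xk; apply/imsetP; exists k; rewrite // -xk.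
have cardR : #|rootF| <= p.*2 by rewrite -[leqRHS]card_ord leq_imset_card.
have := subset_leq_card subF; rewrite cardsD (setIidPr subF).
have V2 : 1 < #|vertex G|.
  by rewrite (cardD1 (src e1)) (cardD1 (tgt e1)) !inE eq_sym loopless.
have := (sum_drop, card_darts, card_darts_edges, card_nonroot_darts).
move: euler p_gt0 V2 cardR; set S := \sum_d _; set SN := \sum_(f in _ :\: _) _.
set SR := \sum_(f in rootF) _.
move: #|rootF| #|faces G| #|edges G| #|vertex G| #|dart G| => R F E V D.
move: #|_| S SN SR => N S SN SR; case: p => // q.
move=> eul _ V2 leR [[[S2 DV] DE] ND] RF leSN SE.
(* Writing [p = q + 1] and [V = x + 2] frees the main counts from truncated subtraction. *)
have [x Vx] : exists x, V = x.+2 by exists (V.-2); lia.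
have Fq : F = q * x + q.*2.+2 by nia.
have Sq : S = q.+1.*2 * (q * x) by nia.
have leF : q * x + (q.+1.*2 - R) <= F - R by lia.
nia.
Qed.

Lemma root_face_drop d (k : 'I_p.*2) :
  left_face d = left_face (root_dart e1 k) -> drop d = 0.
Proof.
move=> dk; have fR : left_face d \in rootF by rewrite dk; apply: imset_f.
have [_ /eqP] := face_count; rewrite sum_nat_eq0 => /forall_inP/(_ _ fR).
by rewrite sum_nat_eq0 => /forall_inP/(_ d (eqxx _))/eqP.
Qed.

Lemma root_face_inj : injective (fun k : 'I_p.*2 => left_face (root_dart e1 k)).
Proof.
have inj : {in [set: 'I_p.*2] &,
    injective (fun k : 'I_p.*2 => left_face (root_dart e1 k))}.
  apply/imset_injP/eqP; rewrite cardsT card_ord -[RHS](proj1 face_count).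
  by apply: eq_card => f; apply/imsetP/imsetP => -[k _ ->]; exists k.
by move=> j k; apply: inj; rewrite inE.
Qed.

(** Along the root-face between the two root-edges nothing drops, so the first dart after leaving
    the root and the dart returning to it share their label. *)
Lemma root_label_succ (k l : 'I_p.*2) : l = k.+1 :> nat ->
  L (opp (root_dart e1 l)) = L (cw (opp (root_dart e1 k))).
Proof.
move=> lk; set x := root_dart e1 k; set y := root_dart e1 l.
have [loopless _ _] := planeG.
have yx : y = ccw x by rewrite /y lk.
(* As the root-faces are pairwise distinct, the boundary leaves the root only once. *)
have only_x d : d \in left_face x -> src d = r -> d = x.
  move=> /left_face_eq df /(root_dartP Greg)[m dm].
  by rewrite dm /x; congr root_dart; congr nat_of_ord; apply: root_face_inj; rewrite -dm.
have label_face d : d \in left_face x -> src d != r -> L d = L (face_next x).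
  rewrite inE => /iter_findex <-; elim: (findex _ _ _) => [|m IH] /=.
    by rewrite src_root_dart eqxx.
  set z := iter m _ _ in IH *.
  have zf : z \in left_face x by rewrite inE fconnect_iter.
  have [/(only_x _ zf) -> //|nz] := eqVneq (src z) r => nz'.
  have nroot : ~~ at_root e1 z by rewrite /at_root negb_or nz -src_face_next.
  rewrite -IH //; have := drop_label nroot; have := label_lt LP nz'.
  rewrite (root_face_drop (k := k)) ?(left_face_eq zf) // add0n.
  by case: ltnP; lia.
have ny : face_next (opp y) = x by rewrite face_next_opp yx ccwK.
apply: label_face; first by rewrite -face_next_in_face ny mem_left_face.
by rewrite -(src_root_dart e1 l) eq_sym; apply: loopless.
Qed.

End FaceCount.

(** * From reduced to even decompositions *)

Section Backward.
Variables (p : nat) (G : rotation_system) (e1 : dart G).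
Variable black : pred {set dart G}.
Hypothesis p_gt0 : 0 < p.
Hypothesis planeG : plane_graph G.
Hypothesis Greg : regular G p.*2.
Hypothesis Gcol : face_coloring e1 black.
Variable T : {ffun 'I_p -> {set dart G}}.
Hypothesis redT : reduced_regular_decomposition e1 black T.
Variable L : dart G -> nat.
Hypothesis LP : is_label e1 black T L.
Implicit Types (d : dart G) (u v : vertex G) (i j k : 'I_p.*2).
Local Notation r := (src e1).

Lemma root_label k : L (opp (root_dart e1 k)) = k.
Proof.
have [loopless _ _] := planeG.
have root_odd j : odd j -> L (opp (root_dart e1 j)) = j.
  move=> oddj; have lt : j./2 < p by have := ltn_ord j; lia.
  have [_ _ _ /(_ (Ordinal lt) j) + _] := redT.
  rewrite (_ : (j == _ :> nat) = true); last by apply/eqP => /=; lia.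
  rewrite mem_edges_of !(mem_label redT LP) src_root_dart eqxx /= => /andP[_ /eqP ->].
  by lia.
have [|evk] := boolP (odd k); first exact: root_odd.
(* The next root-edge has odd index, so its label is prescribed; one turn back gives the label
   [k]. *)
have lt : k.+1 < p.*2 by have := ltn_ord k; lia.
have := root_label_succ p_gt0 planeG Greg Gcol redT LP (l := Ordinal lt) (k := k) erefl.
rewrite root_odd /= ?evk // (label_cw LP); first by case: eqP => // ?; lia.
by rewrite -(src_root_dart e1 k) eq_sym; apply: loopless.
Qed.

Definition label_family : {ffun 'I_p.*2 -> {set dart G}} :=
  [ffun i : 'I_p.*2 => [set d | (src d != r) && (L d == i)]].
Local Notation U := label_family.

Lemma mem_label_family i d : (d \in U i) = (src d != r) && (L d == i).
Proof. by rewrite ffunE inE. Qed.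

Lemma Lambda_label_family : Lambda U = T.
Proof.
by apply/ffunP => j; apply/setP => d; rewrite ffunE mem_label_family (mem_label redT LP).
Qed.

Lemma label_family_opp i d : d \in U i -> opp d \notin U i.
Proof.
rewrite !mem_label_family => /andP[nv /eqP Ld]; apply/negP => /andP[nv' /eqP Ld'].
have := label_odd LP nv; have := label_odd LP nv'.
by rewrite Ld Ld' (black_right_opp Gcol) => ->; case: (black_right _ d).
Qed.

(** Odd classes are the given trees; even classes have unique parents and reach the root by
    [even_label_connect]. *)
Lemma label_family_tree i : oriented_tree r (U i).
Proof.
have [oddi|evi] := boolP (odd i).
  have lt : i./2 < p by have := ltn_ord i; lia.
  suff -> : U i = T (Ordinal lt) by exact: (reduced_tree redT).
  rewrite -Lambda_label_family [RHS]ffunE.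
  suff -> : Ordinal (ltn_Sdouble_ord (Ordinal lt)) = i by [].
  by apply/val_inj => /=; lia.
apply: oriented_tree_of_parents => [d|d|d d'|u].
- exact: label_family_opp.
- by rewrite mem_label_family => /andP[].
- rewrite !mem_label_family => /andP[nv /eqP Ld] /andP[_ /eqP Ld'] sd.
  by apply: (label_unique p_gt0 redT LP); rewrite ?Ld ?Ld'.
have := even_label_connect p_gt0 planeG Greg Gcol redT LP evi (ltn_ord i) u.
by rewrite ffunE.
Qed.

Lemma label_family_cover d : src d != r -> exists i, d \in U i.
Proof.
by move=> nv; exists (Ordinal (label_lt LP nv)); rewrite mem_label_family nv /=.
Qed.

Lemma label_family_unique i j d : d \in U i -> d \in U j -> i = j.
Proof.
rewrite !mem_label_family => /andP[_ /eqP ei] /andP[_ /eqP ej].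
by apply/val_inj; rewrite /= -ei.
Qed.

Lemma label_family_nonroot d : ~~ at_root e1 d -> exists i j,
  [/\ d \in U i, opp d \in U j & odd j = ~~ odd i].
Proof.
move=> nd; have [i dU] := label_family_cover (src_nonroot nd).
have [j odU] := label_family_cover (tgt_nonroot nd); exists i, j; split=> //.
move: dU odU; rewrite !mem_label_family => /andP[_ /eqP <-] /andP[_ /eqP <-].
exact: (label_opp_odd Gcol LP nd).
Qed.

Lemma label_family_even_regular : even_regular_decomposition e1 U.
Proof.
have [loopless _ _] := planeG.
split; last first.
  move=> d i j nd nij; have [i' [j' [di dj oddj]]] := label_family_nonroot nd.
  have memE l : (edge d \in edges_of (U l)) = (l == i') || (l == j').
    rewrite mem_edges_of; apply/idP/idP => /orP[].
    - by move/(label_family_unique di) => ->; rewrite eqxx.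
    - by move/(label_family_unique dj) => ->; rewrite eqxx orbT.
    - by move/eqP->; rewrite di.
    - by move/eqP->; rewrite dj orbT.
  rewrite !memE => /orP[] /eqP ei /orP[] /eqP ej; rewrite ei ej ?eqxx // in nij *.
    by rewrite oddj; case: odd.
  by rewrite oddj; case: odd.
split=> [i||d nd|i j|v nv a aU].
- exact: label_family_tree.
- apply/setP => e; apply/bigcupP/idP => [[i _ /imsetP[d _ ->]]|/imsetP[d _ ->]].
    exact: edge_in_edges.
  have [sd|/label_family_cover[i dU]] := eqVneq (src d) r; last first.
    by exists i; rewrite // mem_edges_of dU.
  have /label_family_cover[i dU] : src (opp d) != r by rewrite -sd eq_sym; apply: loopless.
  by exists i; rewrite // mem_edges_of dU orbT.
- have [i [j [di dj oddj]]] := label_family_nonroot nd; split; last by exists i, j.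
  have nij : i != j by apply/eqP => e; move: oddj; rewrite e; case: odd.
  transitivity #|[set i; j]|; last by rewrite cards2 nij.
  apply: eq_card => l.
  rewrite !inE mem_edges_of; apply/idP/idP => /orP[].
  - by move/(label_family_unique di) => ->; rewrite eqxx.
  - by move/(label_family_unique dj) => ->; rewrite eqxx orbT.
  - by move/eqP->; rewrite di.
  - by move/eqP->; rewrite dj orbT.
- rewrite mem_edges_of !mem_label_family src_root_dart eqxx /= root_label.
  have -> : src (opp (root_dart e1 i)) != r.
    by rewrite -(src_root_dart e1 i) eq_sym; apply: loopless.
  by rewrite eq_sym -val_eqE.
have i00 : 0 < p.*2 by rewrite double_gt0.
apply/(clockwise_ordP a (i0 := Ordinal i00) erefl Greg); case.
elim=> [|m IH] lt; first by congr a; apply: val_inj.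
have [+ sm] := aU (Ordinal (ltnW lt)); rewrite mem_label_family sm nv => /eqP Lm.
have [+ sm1] := aU (Ordinal lt); rewrite mem_label_family sm1 nv => /eqP Lm1.
rewrite /= -(IH (ltnW lt)); apply: (label_unique p_gt0 redT LP); rewrite ?src_cw ?sm ?sm1 //.
rewrite Lm1 (label_cw LP) ?sm // Lm ifF //=.
by apply/negP => /eqP e; have := lt; rewrite {1}e ltnn.
Qed.

End Backward.

Theorem theorem5p5 (p : nat) (G : rotation_system) (e1 : dart G)
    (black : pred {set dart G}) :
  1 < p ->
  plane_graph G ->
  regular G p.*2 ->
  has_mincut G p.*2 ->
  face_coloring e1 black ->
  set_bij (@even_regular_decomposition G e1 p)
    (@reduced_regular_decomposition G e1 black p)
    (@Lambda G p).
Proof.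
move=> /ltnW p_gt0 planeG Greg _ Gcol; split=> [T evT|T U|T redT].
- exact: (Lambda_reduced Greg Gcol p_gt0 evT).
- move=> /classical_sets.set_mem[regT _] /classical_sets.set_mem[regU _].
  exact: (Lambda_injective Greg regT regU).
have [L LP] := label_ex p_gt0 Greg Gcol redT.
exists (label_family p e1 L); last exact: (Lambda_label_family redT LP).
exact: (label_family_even_regular p_gt0 planeG Greg Gcol redT LP).
Qed.
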